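(* Let $(\beta_n)$ be a sequence in $\mathbb{R}^p$ such that $n\beta_n/\lambda_n^*\to\zeta\in\overline{\mathbb{R}}^p$ as $n\to\infty$. Then, when the true parameter for sample size $n$ is $\beta_n$, $$\frac{n}{\lambda_n^*}(\hat\beta_L-\beta_n)\ \longrightarrow\ m = \operatorname{arg\,min}_{u\in\mathbb{R}^p}V^\zeta(u)\quad\text{in probability},$$ where $$V^\zeta(u) = u'Cu + 2\sum_{j=1}^p\lambda_{0,j}\left[\mathbf{1}_{\{\zeta_j\in\mathbb{R}\}}(|u_j+\zeta_j|-|\zeta_j|) + \mathbf{1}_{\{|\zeta_j|=\infty\}}\mathrm{sgn}(\zeta_j)u_j\right].$$
   Context: For each $n \ge p$ consider $y = X\beta+\varepsilon$, where $X$ is a non-random real $n\times p$ matrix of full column rank $p$ that changes with $n$ only by appending rows, $\beta\in\mathbb{R}^p$ (allowed to depend on $n$), and $\varepsilon$ has $n$ independent identically distributed components (with the same law for all $n$; normality is not assumed) with mean $0$ and finite variance $\sigma^2$. Assume $X'X/n \to C$ with $C$ finite and positive definite. For non-random tuning parameters $\lambda_{n,j}\ge 0$, the Lasso estimator $\hat\beta_L$ (depending on $n$) is the unique minimizer over $b\in\mathbb{R}^p$ of $\|y-Xb\|^2 + 2\sum_{j=1}^p\lambda_{n,j}|b_j|$. Consistent tuning is assumed: $\lambda_{n,j}/n^{1/2}\to\infty$ for at least one $j$, and $\lambda_{n,j}/n\to0$ for all $j=1,\dots,p$, as $n\to\infty$. Let $\lambda_n^* = \max_{1\le j\le p}\lambda_{n,j}$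 and assume $\lambda_{n,j}/\lambda_n^*\to\lambda_{0,j}\in[0,1]$ for each $j$. $\overline{\mathbb{R}} = \mathbb{R}\cup\{-\infty,\infty\}$. *)

(* Defs.v *)
From HB Require Import structures.
From mathcomp Require Import all_boot all_order all_algebra.
From mathcomp Require Import all_classical all_reals all_analysis.
Set Implicit Arguments.
Unset Strict Implicit.
Unset Printing Implicit Defensive.
Import Order.TTheory GRing.Theory Num.Theory.
Import numFieldNormedType.Exports.
Local Open Scope classical_set_scope.
Local Open Scope ring_scope.

Definition unique_minimizer (R : realType) (V : Type) (f : V -> R) (x : V) : Prop :=
  forall y, y <> x -> f x < f y.

(* Equal to 0 when f has no unique minimizer. *)
Definition argmin (R : realType) (p : nat) (f : 'cV[R]_p -> R) : 'cV[R]_p :=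
  xget 0 [set x | unique_minimizer f x].

(* Squared Euclidean norm; the library norm on matrices is the sup norm. *)
Definition sqnorm (R : realType) (n : nat) (v : 'cV[R]_n) : R :=
  \sum_(i < n) v i 0 ^+ 2.

Definition quadform (R : realType) (p : nat) (C : 'M[R]_p) (u : 'cV[R]_p) : R :=
  (u^T *m C *m u) 0 0.

Definition posdef (R : realType) (p : nat) (C : 'M[R]_p) : Prop :=
  C^T = C /\ forall u : 'cV[R]_p, u != 0 -> 0 < quadform C u.

(* The first n rows of a fixed infinite sequence of rows, so that the design
   matrix changes with n only by appending rows. *)
Definition design (R : realType) (p : nat) (x : nat -> 'rV[R]_p) (n : nat) :
    'M[R]_(n, p) :=
  \matrix_(i < n) x i.

Definition response (R : realType) (n p : nat) (X : 'M[R]_(n, p))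
    (beta : 'cV[R]_p) (T : Type) (eps : 'I_n -> T -> R) (w : T) : 'cV[R]_n :=
  X *m beta + \col_(i < n) eps i w.

Definition lasso_objective (R : realType) (n p : nat) (X : 'M[R]_(n, p))
    (lam : 'I_p -> R) (y : 'cV[R]_n) (b : 'cV[R]_p) : R :=
  sqnorm (y - X *m b) + 2 * \sum_(j < p) lam j * `|b j 0|.

Definition lasso (R : realType) (n p : nat) (X : 'M[R]_(n, p))
    (lam : 'I_p -> R) (y : 'cV[R]_n) : 'cV[R]_p :=
  argmin (lasso_objective X lam y).

(* Starting the maximum at 0 is harmless: tuning parameters are nonnegative. *)
Definition max_tuning (R : realType) (p : nat) (lam : 'I_p -> R) : R :=
  \big[Num.max/0]_(j < p) lam j.

Definition ereal_sgn (R : realType) (z : \bar R) : R :=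
  match z with
  | r%:E => Num.sg r
  | +oo%E => 1
  | -oo%E => -1
  end.

(* On finite zeta_j, fine (zeta_j) is zeta_j seen as a real number. *)
Definition Vlim (R : realType) (p : nat) (C : 'M[R]_p) (lam0 : 'I_p -> R)
    (zeta : 'I_p -> \bar R) (u : 'cV[R]_p) : R :=
  quadform C u + 2 * \sum_(j < p) lam0 j *
    (if zeta j \is a fin_num
     then `|u j 0 + fine (zeta j)| - `|fine (zeta j)|
     else ereal_sgn (zeta j) * u j 0).

Definition mutually_independent (d : measure_display) (T : measurableType d)
    (R : realType) (P : probability T R) (I : finType) (X : I -> {RV P >-> R}) :
    Prop :=
  forall (J : {set I}) (B : I -> set R), (forall i, measurable (B i)) ->
    P (\bigcap_(i in [set` J]) (X i @^-1` B i)) =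
    (\prod_(i in J) P (X i @^-1` B i))%E.

(* The n-th random vector may live on its own probability space. *)
Definition cvg_in_probability (R : realType) (p : nat) (d : nat -> measure_display)
    (T : forall n, measurableType (d n)) (P : forall n, probability (T n) R)
    (Z : forall n, T n -> 'cV[R]_p) (m : 'cV[R]_p) : Prop :=
  forall e : R, 0 < e ->
    P n [set w | e < Num.sqrt (sqnorm (Z n w - m))] @[n --> \oo] --> 0%E.

(* Main.v *)
Require Import Defs.
From HB Require Import structures.
From mathcomp Require Import all_boot all_order all_algebra.
From mathcomp Require Import all_classical all_reals all_analysis.
From mathcomp Require Import measurable_realfun.
From mathcomp Require Import ring lra.
Import Order.TTheory GRing.Theory Num.Theory.
Import numFieldNormedType.Exports.
Local Open Scope classical_set_scope.
Local Open Scope ring_scope.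
Set Implicit Arguments.
Unset Strict Implicit.
Unset Printing Implicit Defensive.

(** Put u = (n / s) (b - beta_n), where s is the largest tuning parameter for
    sample size n.  Up to a constant and a positive factor, the Lasso objective
    at b is then
      u' C_n u + 2 sum_j (h_(n,j)(u_j) - w_j u_j),
    where C_n = X'X / n, w = X' eps / s is the rescaled score, and
    h_(n,j)(t) = (lambda_(n,j) / s) (|t + z| - |z|) with z = n beta_(n,j) / s
    ([lasso_objective_rescale]).  The function V of the limit is of the same
    kind, with score 0: a quadratic form plus a convex Lipschitz penalty for
    each coordinate ([sepquad]).

    Randomness enters only through w, and w tends to 0 in probability.  Indeed
    the errors are independent, hence uncorrelated, so that w_j has variance
    sigma^2 (C_n)_jj n / s^2, and n / s^2 tends to 0 because some tuning
    parameter dominates sqrt n ([noise_vanishes], [score_tail]).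

    What remains is deterministic: minimizers of such functions depend
    continuously on the matrix, the penalties and the score.  A midpoint
    argument shows that a function of this kind grows at least like half its
    quadratic form away from its minimizer ([sepquad_growth]).  Writing this
    for two functions at each other's minimizer and adding up bounds the
    distance of the two minimizers by the variation of the difference of the
    functions between these two points ([sepquad_compare]).  Here this
    difference tends to 0 uniformly on bounded sets ([sepquad_cvg]): if
    zeta_j is infinite, then |t + z| - |z| is exactly sgn(zeta_j) t on any
    given bounded interval, once |z| is large.  Hence the minimizer is close to
    m whenever n is large and w is small ([minimizer_cvg]).

    Probabilities of the events in the conclusion are meaningful because these
    events are measurable: for fixed n the minimizer is a Lipschitz function of
    the score ([minimizer_lipschitz]), and a preimage of an open set under a
    measurable vector is measurable ([measurable_open_preimage]). *)

(** * Squared norms and quadratic forms *)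

Lemma sqnorm_ge0 (R : realType) n (v : 'cV[R]_n) : 0 <= sqnorm v.
Proof. by apply: sumr_ge0 => i _; exact: sqr_ge0. Qed.

Lemma sqnorm_eq0 (R : realType) n (v : 'cV[R]_n) : sqnorm v <= 0 -> v = 0.
Proof.
move=> v0; have {v0} /eqP v0 : sqnorm v == 0 by rewrite eq_le v0 sqnorm_ge0.
apply/colP => i; rewrite mxE; apply/eqP; rewrite -sqrf_eq0; apply/eqP.
by apply: (psumr_eq0P _ v0) => // j _; exact: sqr_ge0.
Qed.

Lemma sqnormN (R : realType) n (v : 'cV[R]_n) : sqnorm (- v) = sqnorm v.
Proof. by apply: eq_bigr => i _; rewrite mxE sqrrN. Qed.

Lemma sqr_coord_le_sqnorm (R : realType) n (v : 'cV[R]_n) i :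
  v i 0 ^+ 2 <= sqnorm v.
Proof.
rewrite /sqnorm (bigD1 i)//= lerDl; apply: sumr_ge0 => j _; exact: sqr_ge0.
Qed.

Lemma quadformE (R : realType) p (A : 'M[R]_p) (u : 'cV[R]_p) :
  quadform A u = \sum_i \sum_j A i j * (u i 0 * u j 0).
Proof.
rewrite /quadform mxE exchange_big; apply: eq_bigr => j _ /=.
rewrite mxE mulr_suml; apply: eq_bigr => i _.
by rewrite mxE; ring.
Qed.

Lemma quadformN (R : realType) p (A : 'M[R]_p) (u : 'cV[R]_p) :
  quadform A (- u) = quadform A u.
Proof.
rewrite !quadformE; apply: eq_bigr => i _; apply: eq_bigr => j _.
by rewrite !mxE mulrNN.
Qed.

(** The parallelogram identity, in the form that makes strict convexity
    quantitative. *)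
Lemma quadform_midpoint (R : realType) p (A : 'M[R]_p) (u v : 'cV[R]_p) :
  quadform A (2^-1 *: (u + v)) =
  2^-1 * (quadform A u + quadform A v) - 4^-1 * quadform A (u - v).
Proof.
rewrite !quadformE -big_split/= !mulr_sumr -sumrB; apply: eq_bigr => i _.
rewrite -big_split/= !mulr_sumr -sumrB; apply: eq_bigr => j _.
by rewrite !mxE; field.
Qed.

(** Carrying the constant c, rather than positive definiteness alone, is what
    makes the estimates uniform in the sample size. *)
Definition coercive (R : realType) p (A : 'M[R]_p) (c : R) :=
  forall u, c * sqnorm u <= quadform A u.

Lemma quadformDZ (R : realType) p (A : 'M[R]_p) (u v : 'cV[R]_p) s :
  A^T = A ->
  quadform A (u + s *: v) =
    quadform A u + 2 * s * (u^T *m (A *m v)) 0 0 + s ^+ 2 * quadform A v.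
Proof.
move=> sA; have vAu : (v^T *m (A *m u)) 0 0 = (u^T *m (A *m v)) 0 0.
  by rewrite -[v^T *m _]trmxK mxE !trmx_mul trmxK sA mulmxA.
rewrite /quadform.
have -> : (u + s *: v)^T = u^T + s *: v^T by apply/matrixP => i j; rewrite !mxE.
rewrite !(mulmxDl, mulmxDr) -!(scalemxAl, scalemxAr) -!mulmxA.
do 3! rewrite [(_ + _ : 'M[R]_(_, _)) 0 0]mxE.
do 4! rewrite [(_ *: _ : 'M[R]_(_, _)) 0 0]mxE.
by rewrite vAu; ring.
Qed.

Lemma posdef_unitmx (R : realType) p (A : 'M[R]_p) : posdef A -> A \in unitmx.
Proof.
move=> [sA pA]; rewrite -row_free_unit -kermx_eq0; apply/rowV0P => v.
move/sub_kermxP => vA; apply/eqP/negPn/negP => v0.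
have := pA v^T; rewrite /quadform trmxK vA mul0mx mxE ltxx.
by move=> /(_ _)/notF; apply; rewrite -(inj_eq trmx_inj) trmxK trmx0.
Qed.

(** Completing the square along w_i = A^-1 e_i gives u_i^2 <= (A^-1)_ii u'Au;
    summing over i, the trace of A^-1 bounds the inverse of the constant. *)
Lemma posdef_coercive (R : realType) p (A : 'M[R]_p) :
  posdef A -> exists2 c, 0 < c & coercive A c.
Proof.
move=> pdA; have uA := posdef_unitmx pdA; have [sA pA] := pdA.
have q_ge0 u : 0 <= quadform A u.
  by have [->|/pA/ltW//] := eqVneq u 0; rewrite /quadform mulmx0 mxE.
pose B := invmx A; pose w i := col i B.
have Aw i : A *m w i = delta_mx i 0.
  by rewrite /w colE mulmxA mulmxV// mul1mx.
have dotE (u : 'cV[R]_p) i : (u^T *m (delta_mx i 0 : 'cV_p)) 0 0 = u i 0.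
  rewrite mxE (bigD1 i)//= big1 => [|j ji]; rewrite !mxE ?eqxx ?mulr1 ?addr0//.
  by rewrite (negPf ji) mulr0.
have qw i : quadform A (w i) = B i i by rewrite /quadform -mulmxA Aw dotE mxE.
have B_gt0 i : 0 < B i i.
  rewrite -qw; apply: pA; apply/negP => /eqP w0; have := Aw i.
  rewrite w0 mulmx0 => /matrixP/(_ i 0); rewrite !mxE !eqxx => /eqP.
  by rewrite eq_sym oner_eq0.
have coordB i (u : 'cV[R]_p) : u i 0 ^+ 2 <= B i i * quadform A u.
  (* This multiple of w_i minimizes the form on the line through u. *)
  have := q_ge0 (u + (- (u i 0 / B i i)) *: w i).
  rewrite quadformDZ// Aw dotE qw => h.
  rewrite -subr_ge0 (_ : _ - _ = B i i * (quadform A u +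
      2 * - (u i 0 / B i i) * u i 0 + (- (u i 0 / B i i)) ^+ 2 * B i i)).
    by rewrite mulr_ge0// ltW.
  by field; exact: lt0r_neq0.
pose t := 1 + \sum_i B i i.
have t0 : 0 < t by apply: ltr_pwDl => //; apply: sumr_ge0 => i _; exact: ltW.
(* The summand 1 in t only keeps it positive in dimension 0. *)
exists t^-1; first by rewrite invr_gt0.
move=> u; rewrite ler_pdivrMl// mulrDl mul1r mulr_suml.
apply: le_trans (_ : \sum_i B i i * quadform A u <= _); last by rewrite lerDr.
exact: ler_sum.
Qed.

Lemma quadform_perturb (R : realType) p (A : 'M[R]_p) (u : 'cV[R]_p) :
  `|quadform A u| <= (\sum_i \sum_j `|A i j|) * sqnorm u.
Proof.
rewrite quadformE mulr_suml; apply: le_trans (ler_norm_sum _ _ _) _.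
apply: ler_sum => i _; rewrite mulr_suml.
apply: le_trans (ler_norm_sum _ _ _) _; apply: ler_sum => j _.
rewrite normrM ler_wpM2l// normrM.
have := sqr_coord_le_sqnorm u i; have := sqr_coord_le_sqnorm u j.
rewrite -(real_normK (num_real (u i 0))) -(real_normK (num_real (u j 0))).
by move: `|u i 0| `|u j 0| => a b h1 h2; nra.
Qed.

Lemma quadformBmx (R : realType) p (A B : 'M[R]_p) (u : 'cV[R]_p) :
  quadform (A - B) u = quadform A u - quadform B u.
Proof. by rewrite /quadform mulmxBr mulmxBl !mxE. Qed.

Lemma coercive_perturb (R : realType) p (A B : 'M[R]_p) c d :
  coercive A c -> \sum_i \sum_j `|(B - A) i j| <= d -> coercive B (c - d).
Proof.
move=> cA AB u; have := quadform_perturb (B - A) u; rewrite quadformBmx.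
rewrite ler_norml => /andP[+ _]; have := cA u; have := sqnorm_ge0 u.
have := ler_wpM2r (sqnorm_ge0 u) AB.
by move: (quadform A u) (quadform B u) (sqnorm u) (\sum_i _) => a b s x; nra.
Qed.

(** * Minimizers of separably penalized quadratic forms *)

Definition sepquad (R : realType) p (A : 'M[R]_p) (h : 'I_p -> R -> R)
    (u : 'cV[R]_p) : R :=
  quadform A u + 2 * \sum_j h j (u j 0).

(** Convexity at midpoints suffices throughout, and is inherited at once by
    sums and linear perturbations. *)
Definition midconvex (R : realType) (f : R -> R) :=
  forall s t, f (2^-1 * (s + t)) <= 2^-1 * (f s + f t).

Definition lipschitz_fun (R : realType) (L : R) (f : R -> R) :=
  forall s t, `|f s - f t| <= L * `|s - t|.

Lemma cvg_sumr (R : realType) (I : finType) (T : Type) (F : set_system T)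
    {FF : Filter F} (f : I -> T -> R) (a : I -> R) :
  (forall i, f i x @[x --> F] --> a i) ->
  \sum_i f i x @[x --> F] --> \sum_i a i.
Proof. by move=> fa; apply: cvg_big => //; exact: add_continuous. Qed.

Section separable_minimization.
Context {R : realType} {p : nat}.
Implicit Types (A : 'M[R]_p) (h : 'I_p -> R -> R) (u m : 'cV[R]_p) (c L : R).

(** Compare the value at m with the value at the midpoint of u and m: convexity
    of the penalties and the parallelogram identity leave a quarter of the
    quadratic form, which doubles when solved for the value at u. *)
Lemma sepquad_growth A h m u : (forall j, midconvex (h j)) ->
  (forall v, sepquad A h m <= sepquad A h v) ->
  sepquad A h m + 2^-1 * quadform A (u - m) <= sepquad A h u.
Proof.
move=> hcvx mmin; have := mmin (2^-1 *: (u + m)).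
rewrite {2}/sepquad quadform_midpoint => Hm.
have : \sum_j h j ((2^-1 *: (u + m)) j 0) <=
    2^-1 * (\sum_j h j (u j 0) + \sum_j h j (m j 0)).
  rewrite -big_split/= mulr_sumr; apply: ler_sum => j _.
  by rewrite !mxE; exact: hcvx.
rewrite /sepquad in Hm *; lra.
Qed.

Lemma sepquad_unique_minimizer A h m c : 0 < c -> coercive A c ->
  (forall j, midconvex (h j)) ->
  (forall v, sepquad A h m <= sepquad A h v) ->
  unique_minimizer (sepquad A h) m.
Proof.
move=> c0 Ac hcvx mmin y ym; apply: lt_le_trans (sepquad_growth y hcvx mmin).
rewrite ltrDl mulr_gt0 ?invr_gt0//; apply: lt_le_trans (Ac _).
rewrite mulr_gt0// ltNge; apply/negP => /sqnorm_eq0/eqP.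
by rewrite subr_eq0 => /eqP.
Qed.

(** A linear penalty cannot compensate a quadratic form far from the origin.
    This confines minimizers to a ball whose radius depends only on c, L
    and p, which gives both existence and a bound uniform in the sample size. *)
Lemma sepquad_level_bound A h c L u : 0 < c -> coercive A c ->
  (forall j, lipschitz_fun L (h j)) -> sepquad A h u <= sepquad A h 0 ->
  sqnorm u <= 4 * p%:R * L ^+ 2 / c ^+ 2.
Proof.
have q0 : quadform A 0 = 0 by rewrite /quadform mulmx0 mxE.
move=> c0 Ac hL; rewrite /sepquad q0 add0r.
rewrite -lerBrDr -mulrBr -sumrB => h0.
have hj : \sum_j (h j ((0 : 'cV_p) j 0) - h j (u j 0)) <=
    \sum_(j < p) (c / 4 * u j 0 ^+ 2 + L ^+ 2 / c).
  apply: ler_sum => j _; rewrite mxE.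
  apply: le_trans (ler_norm _) (le_trans (hL _ _ _) _).
  rewrite sub0r normrN -(real_normK (num_real (u j 0))).
  rewrite -subr_ge0 (_ : _ - _ = c^-1 * (c / 2 * `|u j 0| - L) ^+ 2).
    by rewrite mulr_ge0 ?sqr_ge0// invr_ge0 ltW.
  by field; exact: lt0r_neq0.
rewrite [X in _ <= X]big_split/= -mulr_sumr -/(sqnorm u) in hj.
rewrite sumr_const card_ord -mulr_natl in hj.
have := Ac u => Acu.
have h1 : c / 2 * sqnorm u <= 2 * (p%:R * (L ^+ 2 / c)).
  by move: (quadform A u) h0 Acu => q h0 Acu; lra.
rewrite ler_pdivlMr ?exprn_gt0//.
have := ler_wpM2l (ltW c0) h1.
rewrite (_ : c * (2 * _) = 2 * p%:R * L ^+ 2); last by field; exact: lt0r_neq0.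
by rewrite mulrCA mulrA => h2; lra.
Qed.

(** Outside a large box the objective exceeds its value at 0, and on the box it
    attains its minimum by compactness. *)
Lemma sepquad_exists_minimizer A h c L : 0 < c -> coercive A c ->
  (forall j, midconvex (h j)) -> (forall j, lipschitz_fun L (h j)) ->
  exists m, unique_minimizer (sepquad A h) m.
Proof.
move=> c0 Ac hcvx hL.
pose K := 4 * p%:R * L ^+ 2 / c ^+ 2 + 1.
(* Compactness is that of a box of row vectors, hence the transposes below. *)
pose box := [set v : 'rV[R]_p | forall i, v ord0 i \in `[(- K), K]].
have cbox : compact box.
  apply: (@rV_compact _ _ (fun=> `[(- K), K]%classic)).
  by move=> _; apply: segment_compact.
have K0 : 0 <= K.
  by rewrite addr_ge0// divr_ge0 ?sqr_ge0// mulr_ge0 ?sqr_ge0// -natrM ler0n.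
have box0 : box 0 by move=> i; rewrite mxE in_itv/= oppr_le0 K0.
have hcont j : continuous (h j).
  move=> t; apply/cvgrPdist_lt => e e0.
  have L0 : 0 < `|L| + 1 by rewrite ltr_wpDl.
  near=> s; apply: le_lt_trans (hL _ _ _) _.
  apply: le_lt_trans (_ : (`|L| + 1) * `|t - s| < e).
    by rewrite ler_wpM2r// (le_trans (ler_norm _))// lerDl.
  rewrite mulrC -ltr_pdivlMr//.
  near: s; apply: (@cvgr_dist_lt _ _ _ _ _ id t) => //.
  by rewrite divr_gt0.
have coordc i : continuous (fun v : 'rV[R]_p => v 0 i).
  exact: coord_continuous.
have fcont : continuous (fun v : 'rV[R]_p => sepquad A h v^T).
  have fE : (fun v : 'rV[R]_p => sepquad A h v^T) = (fun v =>
      \sum_i \sum_j A i j * (v 0 i * v 0 j) + 2 * \sum_j h j (v 0 j)).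
    apply/funext => v; rewrite /sepquad quadformE; congr (_ + 2 * _).
      by apply: eq_bigr => i _; apply: eq_bigr => j _; rewrite !mxE.
    by apply: eq_bigr => j _; rewrite mxE.
  rewrite fE => v.
  have : forall F : set_system 'rV[R]_p, Filter F ->
      (forall i, u 0 i @[u --> F] --> v 0 i) ->
      (\sum_i \sum_j A i j * (u 0 i * u 0 j) + 2 * \sum_j h j (u 0 j))
        @[u --> F] -->
      \sum_i \sum_j A i j * (v 0 i * v 0 j) + 2 * \sum_j h j (v 0 j).
    move=> F FF Fv; apply: cvgD.
      by do 2!apply: cvg_sumr => ?; apply: cvgMl_tmp; exact: cvgM.
    apply: cvgMl_tmp; apply: cvg_sumr => j.
    by apply: (cvg_comp _ _ (Fv j)); exact: hcont.
  move=> H; exact: (H _ (nbhs_filter v) (fun i => coordc i v)).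
have [m mbox mmin] : exists2 m, m \in box &
    forall v, v \in box -> sepquad A h m^T <= sepquad A h v^T.
  apply: EVT_min_rV => //; first by exists 0.
  exact: continuous_subspaceT.
exists m^T; apply: (sepquad_unique_minimizer c0 Ac hcvx) => v.
have [vle|vgt] := leP (sepquad A h v) (sepquad A h 0); last first.
  apply: le_trans (ltW vgt); rewrite -[X in _ <= sepquad A h X]trmxK trmx0.
  by apply: mmin; rewrite inE.
rewrite -(trmxK v); apply: mmin; rewrite inE => i; rewrite mxE.
have := sepquad_level_bound c0 Ac hL vle; have := sqr_coord_le_sqnorm v i.
rewrite in_itv/= -ler_norml -(real_normK (num_real (v i 0))) -/K => a b.
have {b} := le_trans a b.
have -> : 4 * p%:R * L ^+ 2 / c ^+ 2 = K - 1 by rewrite /K addrK.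
by move=> a1; nra.
Unshelve. all: by end_near.
Qed.

(** The growth inequality for each function, evaluated at the minimizer of the
    other: only the variation of their difference between the two minimizers
    survives, so that constants are irrelevant. *)
Lemma sepquad_compare A A' h h' c c' m m' :
  0 < c -> 0 < c' -> coercive A c -> coercive A' c' ->
  (forall j, midconvex (h j)) -> (forall j, midconvex (h' j)) ->
  unique_minimizer (sepquad A h) m -> unique_minimizer (sepquad A' h') m' ->
  2^-1 * (c + c') * sqnorm (m' - m) <=
    (sepquad A h m' - sepquad A' h' m') - (sepquad A h m - sepquad A' h' m).
Proof.
move=> c0 c0' Ac Ac' hc hc' um um'.
have min_le (f : 'cV[R]_p -> R) x :
    unique_minimizer f x -> forall v, f x <= f v.
  by move=> ux v; have [->//|/eqP/ux/ltW] := eqVneq v x.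
have := sepquad_growth m' hc (min_le _ _ um).
have := sepquad_growth m hc' (min_le _ _ um').
have := Ac (m' - m); have := Ac' (m' - m).
rewrite -[quadform A' (m - m')]quadformN opprB.
move: (quadform A _) (quadform A' _) (sqnorm _) => q q' s.
move: (sepquad A h m) (sepquad A h m') (sepquad A' h' m) (sepquad A' h' m').
by move=> a b d e; nra.
Qed.

End separable_minimization.

(** * Rescaled absolute-value penalties *)

(** The Lasso penalty of one coordinate in the local scale around the true
    parameter, whose rescaled value is z. *)
Definition shifted_abs (R : realType) (l z t : R) : R := l * (`|t + z| - `|z|).

Definition shifted_abs_lim (R : realType) (l : R) (z : \bar R) (t : R) : R :=
  l * (if z \is a fin_num then `|t + fine z| - `|fine z| else ereal_sgn z * t).

(** The score enters the rescaled objective as a linear perturbation, which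
    preserves the separable form. *)
Definition tilt (R : realType) p (h : 'I_p -> R -> R) (w : 'cV[R]_p) j t : R :=
  h j t - w j 0 * t.

Section penalties.
Context {R : realType}.
Implicit Types (l z t L : R) (f : R -> R).

Lemma midconvex_linear f a : midconvex f -> midconvex (fun t => f t - a * t).
Proof. by move=> cf s t; have := cf s t; nra. Qed.

Lemma midconvex_shifted_abs l z : 0 <= l -> midconvex (shifted_abs l z).
Proof.
move=> l0 s t; rewrite /shifted_abs.
have -> : 2^-1 * (l * (`|s + z| - `|z|) + l * (`|t + z| - `|z|)) =
  l * (2^-1 * (`|s + z| + `|t + z|) - `|z|) by field.
rewrite ler_wpM2l// lerB//.
rewrite (_ : _ + z = 2^-1 * ((s + z) + (t + z))); last by field.
by rewrite normrM ger0_norm ?invr_ge0// ler_wpM2l ?invr_ge0// ler_normD.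
Qed.

Lemma midconvex_shifted_abs_lim l (z : \bar R) :
  0 <= l -> midconvex (shifted_abs_lim l z).
Proof.
move=> l0; rewrite /shifted_abs_lim; case: (boolP (z \is a fin_num)) => zfin.
  exact: midconvex_shifted_abs.
by move=> s t; rewrite le_eqVlt; apply/orP; left; apply/eqP; field.
Qed.

Lemma lipschitz_linear L f a :
  lipschitz_fun L f -> lipschitz_fun (L + `|a|) (fun t => f t - a * t).
Proof.
move=> fL s t; rewrite (_ : _ - _ - _ = (f s - f t) - a * (s - t)); last by ring.
by rewrite mulrDl -normrM; apply: le_trans (ler_normB _ _) _; rewrite lerD2r.
Qed.

Lemma lipschitz_funW L L' f : L <= L' -> lipschitz_fun L f -> lipschitz_fun L' f.
Proof. by move=> LL' fL s t; apply: le_trans (fL s t) _; rewrite ler_wpM2r. Qed.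

Lemma lipschitz_shifted_abs l z : 0 <= l -> lipschitz_fun l (shifted_abs l z).
Proof.
move=> l0 s t; rewrite /shifted_abs -mulrBr normrM ger0_norm// ler_wpM2l//.
rewrite opprB addrA subrK; apply: le_trans (ler_dist_dist _ _) _.
by rewrite opprD addrACA subrr addr0.
Qed.

Lemma lipschitz_shifted_abs_lim l (z : \bar R) :
  0 <= l -> lipschitz_fun l (shifted_abs_lim l z).
Proof.
move=> l0; rewrite /shifted_abs_lim; case: (boolP (z \is a fin_num)) => zfin.
  exact: lipschitz_shifted_abs.
move=> s t; rewrite -!mulrBr !normrM ger0_norm// ler_wpM2l//.
case: z zfin => [r| |]//= _; first by rewrite normr1 mul1r.
by rewrite normrN1 mul1r.
Qed.

(** For an infinite limit z the increment |t + z_n| - |z_n| is linear in t as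
    soon as |z_n| exceeds the bound on |t|; for a finite one, use that the
    absolute value is 1-Lipschitz. *)
Lemma shifted_abs_cvg (l_ z_ : nat -> R) l (z : \bar R) :
  l_ n @[n --> \oo] --> l -> (z_ n)%:E @[n --> \oo] --> z ->
  forall K e, 0 < e -> \forall n \near \oo, forall t, `|t| <= K ->
    `|shifted_abs (l_ n) (z_ n) t - shifted_abs_lim l z t| <= e.
Proof.
move=> lcvg zcvg K0 e e0.
have [K K_gt0 K0K] : exists2 K, 0 < K & K0 <= K.
  exists (`|K0| + 1); first by rewrite ltr_wpDl.
  by rewrite (le_trans (ler_norm _))// lerDl.
(* The error splits as (l_n - l) (|t + z_n| - |z_n|) + l D_n(t). *)
pose D n t := `|t + z_ n| - `|z_ n| -
  (if z \is a fin_num then `|t + fine z| - `|fine z| else ereal_sgn z * t).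
have D_small e' : 0 < e' ->
    \forall n \near \oo, forall t, `|t| <= K -> `|D n t| <= e'.
  move=> e'0; rewrite /D; case: z zcvg {D} => [r| |] zcvg.
  - have {}zcvg : z_ n @[n --> \oo] --> r by exact: (fine_cvg zcvg).
    near=> n => t _ /=.
    have zr : `|z_ n - r| <= e' / 2.
      near: n; apply: (@cvgr_distC_le _ _ _ _ _ z_ r) => //; exact: divr_gt0.
    have h1 := ler_dist_dist (z_ n) r.
    have h2 := ler_dist_dist (t + z_ n) (t + r).
    rewrite opprD addrACA subrr add0r in h2.
    move: h1 h2; rewrite !ler_norml.
    by move=> /andP[? ?] /andP[? ?]; apply/andP; split; lra.
  - near=> n => t tK /=.
    have zK : K <= z_ n.
      near: n; move/cvgeyPge : zcvg => /(_ K).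
      by apply: filterS => n; rewrite lee_fin.
    move: tK; rewrite ler_norml => /andP[t1 t2].
    have tz0 : 0 <= t + z_ n by lra.
    have z0 : 0 <= z_ n by lra.
    rewrite mul1r (ger0_norm tz0) (ger0_norm z0).
    by rewrite (_ : _ - _ = 0) ?normr0 ?ltW//; ring.
  - near=> n => t tK /=.
    have zK : z_ n <= - K.
      near: n; move/cvgeNyPle : zcvg => /(_ (- K)).
      by apply: filterS => n; rewrite lee_fin.
    move: tK; rewrite ler_norml => /andP[t1 t2].
    have tz0 : t + z_ n <= 0 by lra.
    have z0 : z_ n <= 0 by lra.
    rewrite (ler0_norm tz0) (ler0_norm z0).
    by rewrite (_ : _ - _ = 0) ?normr0 ?ltW//; ring.
have l1 : 0 < `|l| + 1 by rewrite ltr_wpDl.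
near=> n => t tK0.
have tK : `|t| <= K by exact: le_trans K0K.
have Dn : `|D n t| <= e / 2 / (`|l| + 1).
  by move: t tK {tK0}; near: n; apply: D_small; rewrite !divr_gt0.
have ln : `|l_ n - l| <= e / 2 / K.
  near: n; apply: (@cvgr_distC_le _ _ _ _ _ l_ l) => //; rewrite !divr_gt0//.
rewrite /shifted_abs /shifted_abs_lim.
rewrite (_ : _ - _ = (l_ n - l) * (`|t + z_ n| - `|z_ n|) + l * D n t);
  last first.
  by rewrite /D; ring.
apply: le_trans (ler_normD _ _) _; rewrite !normrM [leRHS](splitr e) lerD//.
  rewrite -(divfK (lt0r_neq0 K_gt0) (e / 2)) ler_pM//.
  apply: le_trans (ler_dist_dist _ _) _; by rewrite addrK.
rewrite -(divfK (lt0r_neq0 l1) (e / 2)) mulrC ler_pM// ?lerDl//.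
Unshelve. all: by end_near.
Qed.

End penalties.

(** * The Lasso objective in local coordinates *)

Section rescaling.
Context {R : realType} {n p : nat}.
Implicit Types (X : 'M[R]_(n, p)) (lam : 'I_p -> R) (b u beta : 'cV[R]_p).

Lemma argmin_unique (f : 'cV[R]_p -> R) b : unique_minimizer f b -> argmin f = b.
Proof.
move=> fb; apply: xget_unique => // b' fb' /=; apply: contrapT => bb'.
by have := lt_trans (fb _ bb') (fb' _ (nesym bb')); rewrite ltxx.
Qed.

Lemma sqnormB_mulmx X (e : 'cV[R]_n) b :
  sqnorm (e - X *m b) =
    sqnorm e - 2 * \sum_j (X^T *m e) j 0 * b j 0 + quadform (X^T *m X) b.
Proof.
have sqnormE (v : 'cV[R]_n) : sqnorm v = (v^T *m v) 0 0.
  by rewrite mxE; apply: eq_bigr => i _; rewrite mxE -expr2.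
have -> : quadform (X^T *m X) b = sqnorm (X *m b).
  by rewrite sqnormE /quadform trmx_mul !mulmxA.
have -> : \sum_j (X^T *m e) j 0 * b j 0 = \sum_i e i 0 * (X *m b) i 0.
  transitivity (((X^T *m e)^T *m b) 0 0).
    by rewrite mxE; apply: eq_bigr => j _; rewrite [in RHS]mxE.
  rewrite trmx_mul trmxK -mulmxA mxE.
  by apply: eq_bigr => i _; rewrite [X in X * _]mxE.
rewrite /sqnorm mulr_sumr -sumrB -big_split/=; apply: eq_bigr => i _.
by rewrite !mxE; ring.
Qed.

Definition rescaled_lasso X lam beta (s : R) (w : 'cV[R]_p) : 'cV[R]_p -> R :=
  sepquad (n%:R^-1 *: (X^T *m X))
    (tilt (fun j => shifted_abs (lam j / s) (n%:R * beta j 0 / s)) w).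

(** Expand the square of the residual eps - X (b - beta); the penalty is shifted
    by its value at beta, which accounts for the constant. *)
Lemma lasso_objective_rescale X lam beta (e : 'cV[R]_n) (s : R) u :
  (0 < n)%N -> 0 < s ->
  lasso_objective X lam (X *m beta + e) (beta + (s / n%:R) *: u) =
    sqnorm e + 2 * (\sum_j lam j * `|beta j 0|) +
    s ^+ 2 / n%:R * rescaled_lasso X lam beta s (s^-1 *: (X^T *m e)) u.
Proof.
move=> n0 s0; have N0 : 0 < n%:R :> R by rewrite ltr0n.
have s_neq0 := lt0r_neq0 s0; have N_neq0 := lt0r_neq0 N0.
rewrite /lasso_objective mulmxDr opprD addrACA subrr add0r sqnormB_mulmx.
rewrite /rescaled_lasso /sepquad !quadformE -!addrA; congr (_ + _).
rewrite [in RHS]mulrDr [in RHS]addrCA [in LHS]addrCA; congr (_ + _).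
  rewrite mulr_sumr; apply: eq_bigr => i _; rewrite mulr_sumr.
  apply: eq_bigr => j _; rewrite ![in LHS]mxE ![in RHS]mxE.
  by field; rewrite N_neq0.
rewrite -mulrN -sumrN -mulrDr -big_split/= mulrCA -mulrDr; congr (2 * _).
rewrite mulr_sumr -big_split/=; apply: eq_bigr => j _.
rewrite /tilt /shifted_abs [(beta + _) j 0]mxE [((s / n%:R) *: u) j 0]mxE.
rewrite [(s^-1 *: (X^T *m e)) j 0]mxE.
have normE (a c : R) : a = s / n%:R * c -> `|a| = s / n%:R * `|c|.
  by move=> ->; rewrite normrM ger0_norm// divr_ge0// ltW.
rewrite (normE (beta j 0 + s / n%:R * u j 0)
  (u j 0 + n%:R * beta j 0 / s)); last first.
  by field; rewrite N_neq0 s_neq0.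
rewrite (normE (beta j 0) (n%:R * beta j 0 / s)); last first.
  by field; rewrite N_neq0 s_neq0.
by field; rewrite N_neq0 s_neq0.
Qed.

(** The change of variables is an affine bijection, so it maps unique minimizers
    to unique minimizers. *)
Lemma lasso_rescale X lam beta (e : 'cV[R]_n) (s : R) u :
  (0 < n)%N -> 0 < s ->
  unique_minimizer (rescaled_lasso X lam beta s (s^-1 *: (X^T *m e))) u ->
  (n%:R / s) *: (lasso X lam (X *m beta + e) - beta) = u.
Proof.
move=> n0 s0 uu; have N0 : 0 < n%:R :> R by rewrite ltr0n.
have s_neq0 := lt0r_neq0 s0; have N_neq0 := lt0r_neq0 N0.
rewrite /lasso (@argmin_unique _ (beta + (s / n%:R) *: u)).
  rewrite addrC addKr scalerA (_ : _ * _ = 1) ?scale1r//.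
  by field; rewrite N_neq0 s_neq0.
move=> b bu; pose v := (n%:R / s) *: (b - beta).
have bE : b = beta + (s / n%:R) *: v.
  rewrite /v scalerA (_ : _ * _ = 1) ?scale1r ?subrKC//.
  by field; rewrite N_neq0 s_neq0.
rewrite bE !lasso_objective_rescale// ltrD2l ltr_pM2l ?divr_gt0 ?exprn_gt0//.
by apply: uu => vu; apply: bu; rewrite bE vu.
Qed.

End rescaling.

(** * Convergence and stability of minimizers *)

Section deterministic_limit.
Context {R : realType} {p : nat}.
Variables (A_ : nat -> 'M[R]_p) (A : 'M[R]_p).
Variables (l_ : nat -> 'I_p -> R) (l : 'I_p -> R).
Variables (z_ : nat -> 'I_p -> R) (z : 'I_p -> \bar R).
Hypothesis A_cvg : forall i j, A_ n i j @[n --> \oo] --> A i j.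
Hypothesis l_cvg : forall j, l_ n j @[n --> \oo] --> l j.
Hypothesis z_cvg : forall j, (z_ n j)%:E @[n --> \oo] --> z j.
Hypothesis l_01 : forall j, 0 <= l j <= 1.
Hypothesis l__01 : \forall n \near \oo, forall j, 0 <= l_ n j <= 1.

Let h_ n j := shifted_abs (l_ n j) (z_ n j).

Lemma matrix_dist_cvg0 e : 0 < e ->
  \forall n \near \oo, \sum_i \sum_j `|(A_ n - A) i j| <= e.
Proof.
move=> e0.
have : \sum_i \sum_j `|(A_ n - A) i j| @[n --> \oo] -->
    \sum_(i < p) \sum_(j < p) (0 : R).
  apply: cvg_sumr => i; apply: cvg_sumr => j; rewrite -(@normr0 _ R).
  apply: cvg_norm; rewrite -(subrr (A i j)).
  under eq_cvg do rewrite !mxE.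
  by apply: cvgB; [exact: A_cvg|exact: cvg_cst].
rewrite big1 => [S0|i _]; last by rewrite big1.
near=> n; have : `|\sum_i \sum_j `|(A_ n - A) i j| - 0| <= e.
  by near: n; apply: (@cvgr_distC_le _ _ _ _ _ _ 0 S0).
by rewrite subr0; exact/le_trans/ler_norm.
Unshelve. all: by end_near.
Qed.

Lemma sepquad_cvg K e : 0 < e -> \forall n \near \oo, forall u : 'cV[R]_p,
  sqnorm u <= K -> `|Vlim A l z u - sepquad (A_ n) (h_ n) u| <= e.
Proof.
move=> e0; have K0 : 0 < `|K| + 1 by rewrite ltr_wpDl.
have p0 : 0 < p%:R + 1 :> R by rewrite ltr_wpDl.
have hA : \forall n \near \oo, \sum_i \sum_j `|(A_ n - A) i j| <=
    e / 2 / (`|K| + 1) by apply: matrix_dist_cvg0; rewrite !divr_gt0.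
have hpen : \forall n \near \oo, forall j t, `|t| <= `|K| + 1 ->
    `|h_ n j t - shifted_abs_lim (l j) (z j) t| <= e / 4 / (p%:R + 1).
  apply: filter_forall => j; apply: shifted_abs_cvg => //.
  by rewrite !divr_gt0.
near=> n => u uK; rewrite distrC.
have -> : sepquad (A_ n) (h_ n) u - Vlim A l z u = quadform (A_ n - A) u +
    2 * \sum_j (h_ n j (u j 0) - shifted_abs_lim (l j) (z j) (u j 0)).
  by rewrite sumrB quadformBmx /Vlim /sepquad /shifted_abs_lim; ring.
rewrite [leRHS](splitr e); apply: le_trans (ler_normD _ _) (lerD _ _).
  apply: le_trans (quadform_perturb _ _) _.
  rewrite -(divfK (lt0r_neq0 K0) (e / 2)) ler_pM ?sqnorm_ge0//.
  - by apply: sumr_ge0 => i _; apply: sumr_ge0.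
  - by near: n.
  - by rewrite (le_trans uK)// (le_trans (ler_norm _))// lerDl.
have uj j : `|u j 0| <= `|K| + 1.
  have := le_trans (sqr_coord_le_sqnorm u j) uK.
  rewrite -(real_normK (num_real (u j 0))); have := ler_norm K.
  by move: `|u j 0| `|K| (normr_ge0 K) => a b b0 Kb aK; nra.
rewrite normrM ger0_norm// -ler_pdivlMl//.
apply: le_trans (ler_norm_sum _ _ _) _.
apply: le_trans (_ : \sum_(j < p) e / 4 / (p%:R + 1) <= _).
  apply: ler_sum => j _; move: (u j 0) (uj j) => t tK; move: j t tK.
  by near: n.
rewrite sumr_const card_ord -[_ *+ p]mulr_natr.
rewrite (_ : 2^-1 * _ = e / 4 / (p%:R + 1) * (p%:R + 1)); last first.
  by field; exact: lt0r_neq0.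
by rewrite ler_wpM2l ?lerDl// !divr_ge0// ltW.
Unshelve. all: by end_near.
Qed.

(** Young's inequality: the score is paid for by its own size and a small
    multiple of the squared distance, which the growth of the objective absorbs. *)
Lemma dot_le (w v : 'cV[R]_p) a : 0 < a ->
  2 * \sum_j w j 0 * v j 0 <= a^-1 * sqnorm w + a * sqnorm v.
Proof.
move=> a0; rewrite /sqnorm !mulr_sumr -big_split/=; apply: ler_sum => j _.
rewrite -subr_ge0.
rewrite (_ : _ - _ = a^-1 * (w j 0 - a * v j 0) ^+ 2).
  by rewrite mulr_ge0 ?sqr_ge0// invr_ge0 ltW.
by field; exact: lt0r_neq0.
Qed.

Lemma sepquad_tilt (B : 'M[R]_p) (h : 'I_p -> R -> R) (w u : 'cV[R]_p) :
  sepquad B (tilt h w) u = sepquad B h u - 2 * \sum_j w j 0 * u j 0.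
Proof. by rewrite /sepquad /tilt sumrB mulrBr addrA. Qed.

(** The comparison of minimizers, with the linear term absorbed by Young's
    inequality.  The bound holds for all small scores w at once, so that a
    random score can be substituted for w. *)
Lemma minimizer_cvg c m : 0 < c -> coercive A c ->
  unique_minimizer (Vlim A l z) m ->
  forall e, 0 < e -> exists2 d, 0 < d & \forall n \near \oo, forall w u,
    sqnorm w <= d -> unique_minimizer (sepquad (A_ n) (tilt (h_ n) w)) u ->
    sqnorm (u - m) <= e.
Proof.
move=> c0 Ac mmin e e0.
(* For large n the matrices A_n are coercive with constant c / 2. *)
pose c' := c / 2; have c'0 : 0 < c' by exact: divr_gt0.
(* Scores in the unit ball give 2-Lipschitz penalties, so that this radius
   captures both minimizers. *)
pose K := Num.max (sqnorm m) (4 * p%:R * 2 ^+ 2 / c' ^+ 2).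
have e'0 : 0 < c * e / 16 by rewrite divr_gt0// mulr_gt0.
(* The comparison reads (3 c / 4) |u - m|^2 <= c e / 8 + (2 / c) |w|^2 +
   (c / 2) |u - m|^2; the choice of d makes the second term at most c e / 8. *)
exists (Num.min 1 (c ^+ 2 * e / 16)).
  by rewrite lt_min ltr01 divr_gt0// mulr_gt0// exprn_gt0.
near=> n => w u; rewrite le_min => /andP[w1 wd] umin.
have An : coercive (A_ n) c'.
  rewrite (_ : c' = c - c'); last by rewrite /c'; field.
  by apply: coercive_perturb Ac _; near: n; exact: matrix_dist_cvg0.
have l01 : forall j, 0 <= l_ n j <= 1 by near: n.
have wj j : `|w j 0| <= 1.
  have := le_trans (sqr_coord_le_sqnorm w j) w1.
  by rewrite -(real_normK (num_real (w j 0))) expr_le1.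
have hcvx j : midconvex (tilt (h_ n) w j).
  by apply/midconvex_linear/midconvex_shifted_abs; case/andP: (l01 j).
have hlip j : lipschitz_fun 2 (tilt (h_ n) w j).
  have /andP[l0 l1] := l01 j.
  apply: (lipschitz_funW (L := l_ n j + `|w j 0|)); first by have := wj j; lra.
  exact/lipschitz_linear/lipschitz_shifted_abs.
have hcvx0 j : midconvex (shifted_abs_lim (l j) (z j)).
  by apply: midconvex_shifted_abs_lim; case/andP: (l_01 j).
have u_le : sepquad (A_ n) (tilt (h_ n) w) u <= sepquad (A_ n) (tilt (h_ n) w) 0.
  by have [->//|/eqP/nesym/umin/ltW] := eqVneq u 0.
have uK : sqnorm u <= K.
  by rewrite le_max (sepquad_level_bound c'0 An hlip u_le) orbT.
have mK : sqnorm m <= K by rewrite le_max lexx.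
have Vn v : sqnorm v <= K ->
    `|Vlim A l z v - sepquad (A_ n) (h_ n) v| <= c * e / 16.
  by move: v; near: n; exact: sepquad_cvg.
have := sepquad_compare c0 c'0 Ac An hcvx0 hcvx mmin umin.
have VE v :
    sepquad A (fun j => shifted_abs_lim (l j) (z j)) v = Vlim A l z v by [].
rewrite !sepquad_tilt !VE.
have := dot_le w (u - m) c'0.
under eq_bigr do rewrite mxE [X in _ + X]mxE mulrBr.
rewrite sumrB.
have := Vn _ uK; have := Vn _ mK; rewrite !ler_norml.
move=> /andP[? ?] /andP[? ?] h1 h2.
have h3 : c'^-1 * sqnorm w <= c * e / 8.
  rewrite ler_pdivrMl//; apply: le_trans wd _.
  by rewrite /c' le_eqVlt; apply/orP; left; apply/eqP; field.
rewrite -(ler_pM2l c0).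
rewrite /c' in h1 h2 h3 *.
have := sqnorm_ge0 (u - m).
move: (sqnorm (u - m)) (_^-1 * sqnorm w) h1 h2 h3 => s t.
lra.
Unshelve. all: by end_near.
Qed.

End deterministic_limit.

(** Two objectives that differ only in the score have a linear difference, so
    that the comparison of minimizers becomes a Lipschitz bound. *)
Lemma minimizer_lipschitz (R : realType) p (A : 'M[R]_p) (h : 'I_p -> R -> R) c
    (w w' u u' : 'cV[R]_p) : 0 < c -> coercive A c ->
  (forall j, midconvex (h j)) ->
  unique_minimizer (sepquad A (tilt h w)) u ->
  unique_minimizer (sepquad A (tilt h w')) u' ->
  c ^+ 2 * sqnorm (u' - u) <= 4 * sqnorm (w' - w).
Proof.
move=> c0 Ac hcvx um um'.
have tcvx v j : midconvex (tilt h v j) by exact/midconvex_linear/hcvx.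
have := sepquad_compare c0 c0 Ac Ac (tcvx w) (tcvx w') um um'.
rewrite !sepquad_tilt => h1.
have c20 : 0 < c / 2 by exact: divr_gt0.
have := dot_le (w' - w) (u' - u) c20.
under eq_bigr => j _ do rewrite mxE [X in _ + X]mxE mxE [X in _ * (_ + X)]mxE
  mulrBr !mulrBl.
rewrite !sumrB => h2.
have h3 : c / 2 * sqnorm (u' - u) <= (c / 2)^-1 * sqnorm (w' - w) by lra.
have := ler_wpM2l (ltW c20) h3; rewrite mulVKf ?lt0r_neq0//.
by move: (sqnorm _) (sqnorm _) => s t; nra.
Qed.

(** * Independence and second moments *)

Section second_moments.
Context {d : measure_display} {T : measurableType d} {R : realType}.
Variable P : probability T R.
Local Open Scope ereal_scope.

(** Independence says that the joint law of X and Y agrees with the product of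
    their laws on rectangles, hence everywhere; Fubini's theorem for the product
    law then factors the expectation. *)
Lemma expectation_mul_indep (X Y : {RV P >-> R}) :
  (forall A B : set R, measurable A -> measurable B ->
    P (X @^-1` A `&` Y @^-1` B) = P (X @^-1` A) * P (Y @^-1` B)) ->
  (X : T -> R) \in Lfun P 1 -> (Y : T -> R) \in Lfun P 1 ->
  (X \* Y)%R \in Lfun P 1 ->
  'E_P[X \* Y] = 'E_P[X] * 'E_P[Y].
Proof.
move=> XYind X1 Y1 XY1.
pose phi w := (X w, Y w).
have mphi : measurable_fun setT phi by exact: measurable_fun_pair.

pose f (z : R * R) : \bar R := (z.1 * z.2)%:E.
have mf : measurable_fun setT f.
  by apply/measurable_EFinP; apply: measurable_funM.
have Pf : P.-integrable (phi @^-1` setT) (f \o phi).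
  by rewrite preimage_setT; exact/Lfun1_integrable.
pose muX := distribution P X; pose muY := distribution P Y.
pose phi_m : {mfun T >-> (R * R)%type} :=
  HB.pack_for {mfun T >-> (R * R)%type} phi (isMeasurableFun.Build _ _ _ _ _ mphi).
have prodE (S : set (R * R)) : measurable S ->
    (muX \x muY) S = distribution P phi_m S.
  by move=> mS; exact: product_measure_unique.
have EXY : 'E_P[X \* Y] = \int[muX \x muY]_z f z.
  rewrite unlock (eq_measure_integral (distribution P phi_m)); last first.
    by move=> S mS _; exact: prodE.
  by rewrite integral_pushforward//.
have intf : (muX \x muY).-integrable setT f.
  have := integrable_pushforward mphi mf Pf measurableT.
  move=> /integrableP[_ h]; apply/integrableP; split => //.
  rewrite (eq_measure_integral (distribution P phi_m))// => S mS _.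
  exact: prodE.
rewrite EXY -integral12_prod_meas1//.
have EXE (Z : {RV P >-> R}) : (Z : T -> R) \in Lfun P 1 ->
    \int[distribution P Z]_x x%:E = 'E_P[Z].
  by move=> /Lfun1_integrable Z1; rewrite unlock integral_distribution.
have intX (Z : {RV P >-> R}) : (Z : T -> R) \in Lfun P 1 ->
    (distribution P Z).-integrable setT EFin.
  by move=> /Lfun1_integrable Z1; exact: integrable_pushforward.
rewrite /fubini_F /f /=.
under eq_integral => x _.
  under eq_integral do rewrite EFinM.
  rewrite integralZl//; last exact: intX.
  rewrite EXE//.
  over.
have EYfin : 'E_P[Y] \is a fin_num by exact: expectation_fin_num.
rewrite -(fineK EYfin) integralZr//; last exact: intX.
by rewrite EXE.
Qed.

Lemma Lfun2_variance (X : {RV P >-> R}) :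
  'E_P[X] = 0 -> 'V_P[X] < +oo -> (X : T -> R) \in Lfun P 2%:E.
Proof.
move=> EX VX; rewrite inE; apply/andP; split; rewrite inE//=.
rewrite /finite_norm unlock /Lnorm poweR_lty//.
move: VX; rewrite /variance unlock EX /= unlock; apply: le_lt_trans.
rewrite le_eqVlt; apply/orP; left; apply/eqP; apply: eq_integral => w _.
congr EFin; rewrite powR_mulrn// real_normK ?num_real//.
by transitivity ((X w - 0) * (X w - 0))%R; rewrite // subr0 expr2.
Qed.

Lemma covariance_indep (X Y : {RV P >-> R}) :
  (forall A B : set R, measurable A -> measurable B ->
    P (X @^-1` A `&` Y @^-1` B) = P (X @^-1` A) * P (Y @^-1` B)) ->
  (X : T -> R) \in Lfun P 2%:E -> (Y : T -> R) \in Lfun P 2%:E ->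
  covariance P X Y = 0.
Proof.
move=> XYind X2 Y2.
have Pfin : P setT \is a fin_num := fin_num_measure P _ measurableT.
have X1 := Lfun_subset12 Pfin X2.
have Y1 := Lfun_subset12 Pfin Y2.
have XY1 := Lfun2_mul_Lfun1 X2 Y2.
rewrite covarianceE// expectation_mul_indep// subee// fin_numM//;
  exact: expectation_fin_num.
Qed.

(** The product rule for the two-element subfamily. *)
Lemma indep_pair (I : finType) (X : I -> {RV P >-> R}) i j :
  mutually_independent X -> i != j ->
  forall A B : set R, measurable A -> measurable B ->
  P (X i @^-1` A `&` X j @^-1` B) = P (X i @^-1` A) * P (X j @^-1` B).
Proof.
move=> Xind ij A B mA mB.
pose F k := if k == i then A else B.
have mF k : measurable (F k) by rewrite /F; case: ifP.
have FiE : F i = A by rewrite /F eqxx.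
have FjE : F j = B by rewrite /F eq_sym (negPf ij).
have := Xind [set i; j]%SET F mF.
rewrite big_setU1 ?inE//= big_set1 FiE FjE => <-; congr (P _).
apply/seteqP; split=> [w [Aw Bw] k|w h].
  by rewrite /= !inE => /orP[/eqP->|/eqP->]; rewrite ?FiE ?FjE.
split.
  by have := h i; rewrite /= FiE; apply; rewrite !inE eqxx.
by have := h j; rewrite /= FjE; apply; rewrite !inE eqxx orbT.
Qed.

Section weighted_sum.
Context {I : finType}.
Variables (X : I -> {RV P >-> R}) (a : I -> R) (v : R).
Hypothesis Xind : mutually_independent X.
Hypothesis EX : forall i, 'E_P[X i] = 0.
Hypothesis VX : forall i, 'V_P[X i] = v%:E.

Let X2 i : (X i : T -> R) \in Lfun P 2%:E.
Proof. by apply: Lfun2_variance; rewrite ?VX ?ltry. Qed.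

Let S r : T -> R := fun w => (\sum_(i <- r) a i * X i w)%R.

Let S_nil : S [::] = cst 0%R.
Proof. by apply/funext => w; rewrite /S big_nil. Qed.

Let S_cons i r : S (i :: r) = (a i \o* X i \+ S r)%R.
Proof. by apply/funext => w; rewrite /S big_cons /= mulrC. Qed.

Let aX2 i : (a i \o* X i)%R \in Lfun P 2%:E.
Proof. by apply: Lfun_scale => //; rewrite ler1n. Qed.

Let S2 r : S r \in Lfun P 2%:E.
Proof.
elim: r => [|i r IH]; first by rewrite S_nil Lfun_cst.
by rewrite S_cons rpredD// lee1n.
Qed.

Let Pfin : P setT \is a fin_num := fin_num_measure P _ measurableT.

Let ES r : 'E_P[S r] = 0.
Proof.
elim: r => [|i r IH]; first by rewrite S_nil expectation_cst.
rewrite S_cons expectationD ?(Lfun_subset12 Pfin)//.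
by rewrite expectationZl ?(Lfun_subset12 Pfin)// EX IH mule0 adde0.
Qed.

Let covS i r : i \notin r -> covariance P (X i) (S r) = 0.
Proof.
elim: r => [_|j r IH]; first by rewrite S_nil covariance_cst_r.
rewrite inE negb_or => /andP[ij ir].
rewrite S_cons covarianceDr// IH// adde0.
rewrite covarianceZr ?Lfun2_mul_Lfun1 ?(Lfun_subset12 Pfin)//.
by rewrite covariance_indep ?mule0//; exact: indep_pair.
Qed.

Let VS r : uniq r -> 'V_P[S r] = (v * \sum_(i <- r) a i ^+ 2)%:E.
Proof.
elim: r => [_|i r IH /= /andP[ir ur]].
  by rewrite S_nil variance_cst big_nil mulr0.
rewrite S_cons varianceD// IH// varianceZ// VX.
rewrite covarianceZl ?Lfun2_mul_Lfun1 ?(Lfun_subset12 Pfin)//.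
by rewrite covS// !mule0 adde0 big_cons -EFinM -EFinD mulrDr mulrC.
Qed.

(** Independent variables are uncorrelated, so that variances of weighted sums
    add up and Chebyshev's inequality applies. *)
Lemma chebyshev_weighted_sum e : (0 < e)%R ->
  P [set w | (e <= `|\sum_i a i * X i w|)%R] <=
    (e ^- 2 * (v * \sum_i a i ^+ 2))%:E.
Proof.
move=> e0; pose r := index_enum I.
have mS : measurable_fun setT (S r).
  by have := sub_Lfun_mfun (S2 r); rewrite inE.
pose SW : {mfun T >-> R} :=
  HB.pack_for {mfun T >-> R} (S r) (isMeasurableFun.Build _ _ _ _ _ mS).
have := @chebyshev _ _ _ P SW e e0.
rewrite /SW /= ES /= VS ?index_enum_uniq// -EFinM.
by under eq_set do rewrite subr0.
Qed.

End weighted_sum.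
End second_moments.

(** * Measurability of the estimation error *)

(** An open set is the union of the countably many rational boxes inside it, and
    the preimage of a box is a finite intersection of measurable sets. *)
Lemma measurable_open_preimage d (T : measurableType d) (R : realType) p
    (W : T -> 'cV[R]_p) (O : set 'cV[R]_p) :
  (forall j, measurable_fun setT (fun w => W w j 0)) -> open O ->
  measurable (W @^-1` O).
Proof.
move=> mW oO.
pose box (qk : 'cV[rat]_p * nat) : set 'cV[R]_p :=
  [set v | forall j, `|v j 0 - ratr (qk.1 j 0)| < qk.2.+1%:R^-1].
pose F qk := if `[< box qk `<=` O >] then W @^-1` box qk else set0.
have -> : W @^-1` O = \bigcup_qk F qk.
  apply/seteqP; split=> [w Ow|w [qk _]]; last first.
    by rewrite /F; case: ifPn => // /asboolP sub /sub.
  have [e /= e0 eO] : exists2 e, 0 < e & ball (W w) e `<=` O.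
    by apply/nbhs_ballP; exact: open_nbhs_nbhs.
  have [k ke] : exists k, k.+1%:R^-1 < e / 2.
    have : \forall k \near \oo, k.+1%:R^-1 < e / 2.
      by apply: near_infty_natSinv_lt (PosNum _); exact: divr_gt0.
    by case=> N _ /(_ N (leqnn N)); exists N.
  have k0 : 0 < k.+1%:R^-1 :> R by rewrite invr_gt0.
  have qP j : exists q : rat, `|W w j 0 - ratr q| < k.+1%:R^-1.
    have /rat_in_itvoo[q] : W w j 0 - k.+1%:R^-1 < W w j 0 + k.+1%:R^-1.
      by move: k0; move: (_^-1) => r; lra.
    rewrite in_itv/= => qI; exists q; move: qI; move: (_^-1) => r /andP[q1 q2].
    by rewrite ltr_norml; apply/andP; split; lra.
  have [q qw] := choice qP.
  exists (\col_j q j, k) => //.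
  rewrite /F asboolT; first by move=> j; rewrite mxE.
  move=> v vq; apply: eO; split=> // i j; rewrite ord1 /ball/=.
  have := vq i; have := qw i; rewrite mxE /= !ltr_norml.
  move: (_^-1) ke => r ke.
  by move=> /andP[? ?] /andP[? ?]; apply/andP; split; lra.
apply: countable_bigcupT_measurable => // qk.
rewrite /F; case: ifPn => // _.
rewrite (_ : _ @^-1` _ = \bigcap_(j in [set: 'I_p])
    ((fun w => W w j 0) @^-1` [set r | `|r - ratr (qk.1 j 0)| < qk.2.+1%:R^-1])).
  apply: fin_bigcap_measurable => // j _; rewrite -[X in measurable X]setTI.
  apply: mW => //.
  rewrite (_ : [set r | _] = `](ratr (qk.1 j 0) - qk.2.+1%:R^-1),
      (ratr (qk.1 j 0) + qk.2.+1%:R^-1)[%classic) //.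
  by apply/seteqP; split=> r /=; rewrite in_itv/= ltr_distl.
by apply/seteqP; split=> w h j; [move=> _|]; exact: h.
Qed.

Lemma sqnorm_continuous (R : realType) p (m : 'cV[R]_p) (T : Type)
    (F : set_system T) {FF : Filter F} (f : T -> 'cV[R]_p) (a : 'cV[R]_p) :
  (forall j, f t j 0 @[t --> F] --> a j 0) ->
  sqnorm (f t - m) @[t --> F] --> sqnorm (a - m).
Proof.
move=> fa; rewrite /sqnorm; apply: cvg_sumr => j.
under eq_cvg do rewrite !mxE expr2.
rewrite !mxE expr2.
by apply: cvgM; (apply: cvgB; [exact: fa|exact: cvg_cst]).
Qed.

(** The minimizer is Lipschitz in the score, hence continuous. *)
Lemma open_minimizer_far (R : realType) p (A : 'M[R]_p) (h : 'I_p -> R -> R) c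
    (u : 'cV[R]_p -> 'cV[R]_p) (m : 'cV[R]_p) e : 0 < c -> coercive A c ->
  (forall j, midconvex (h j)) ->
  (forall w, unique_minimizer (sepquad A (tilt h w)) (u w)) ->
  open [set w | e < sqnorm (u w - m)].
Proof.
move=> c0 Ac hcvx umin.
have coordc i : continuous (fun v : 'cV[R]_p => v i 0).
  exact: coord_continuous.
have ucont j (w : 'cV[R]_p) (F : set_system 'cV[R]_p) : Filter F ->
    (forall i, (fun v : 'cV[R]_p => v i 0) @ F --> w i 0) ->
    u v j 0 @[v --> F] --> u w j 0.
  move=> FF Fw; apply/cvgrPdist_lt => a a0.
  have b0 : 0 < c ^+ 2 / 4 * a ^+ 2.
    by rewrite mulr_gt0 ?exprn_gt0 ?divr_gt0 ?exprn_gt0.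
  have w0 : sqnorm (v - w) @[v --> F] --> (0 : R).
    rewrite (_ : 0 = sqnorm (w - w)); first exact: sqnorm_continuous.
    by rewrite subrr /sqnorm big1// => k _; rewrite mxE expr0n.
  move/cvgrPdist_lt : w0 => /(_ _ b0); apply: filterS => v.
  rewrite sub0r normrN ger0_norm ?sqnorm_ge0// => vw.
  have h1 := minimizer_lipschitz c0 Ac hcvx (umin w) (umin v).
  have h2 := sqr_coord_le_sqnorm (u w - u v) j.
  rewrite -opprB sqnormN in h2.
  rewrite -(real_normK (num_real _)) opprB !mxE in h2.
  have c2 : 0 < c ^+ 2 by exact: exprn_gt0.
  rewrite -(@ltr_pXn2r _ 2)// ?nnegrE ?ltW// -(ltr_pM2l c2).
  move: (sqnorm _) (sqnorm _) h1 h2 vw b0 => s t; nra.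
have fcont : continuous (fun w => sqnorm (u w - m)).
  move=> w; have FF := nbhs_filter w.
  exact: (sqnorm_continuous (m := m)
    (fun j => ucont j w _ FF (fun i => coordc i w))).
rewrite (_ : [set w | _] = (fun w => sqnorm (u w - m)) @^-1` `]e, +oo[);
  last first.
  by apply/seteqP; split => w /=; rewrite in_itv/= andbT.
by move/continuousP : fcont; apply; exact: interval_open.
Qed.

(** * The rescaled score *)

Lemma le_max_tuning (R : realType) p (lam : 'I_p -> R) j :
  lam j <= max_tuning lam.
Proof. exact: le_bigmax. Qed.

(** n / s^2 is the square of the inverse of s / sqrt n, and s dominates every
    tuning parameter. *)
Lemma noise_vanishes (R : realType) p (lam : nat -> 'I_p -> R) j :
  lam n j / Num.sqrt n%:R @[n --> \oo] --> +oo ->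
  n%:R / max_tuning (lam n) ^+ 2 @[n --> \oo] --> (0 : R).
Proof.
move=> lamy.
have sy : max_tuning (lam n) / Num.sqrt n%:R @[n --> \oo] --> +oo.
  apply: ger_cvgy lamy; near=> n.
  by rewrite ler_wpM2r ?le_max_tuning// invr_ge0 sqrtr_ge0.
have sV : (max_tuning (lam n) / Num.sqrt n%:R)^-1 @[n --> \oo] --> (0 : R).
  apply/gtr0_cvgV0 => //.
  by move/cvgryPgt : sy => /(_ 0).
rewrite -(mulr0 (0 : R)); apply: cvg_trans (cvgM sV sV).
apply: near_eq_cvg; near=> n => /=.
have n0 : 0 < n%:R :> R by rewrite ltr0n; near: n; exact: nbhs_infty_gt.
rewrite -[X in _ = X / _](@sqr_sqrtr R n%:R) ?ler0n// invfM invrK.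
by rewrite -expr2 exprMn exprVn mulrC.
Unshelve. all: by end_near.
Qed.

Lemma sum_sqr_design (R : realType) n p (X : 'M[R]_(n, p)) (s : R) j :
  \sum_i (X i j / s) ^+ 2 = (X^T *m X) j j / s ^+ 2.
Proof.
rewrite mxE mulr_suml; apply: eq_bigr => i _.
by rewrite !mxE exprMn exprVn expr2.
Qed.

Lemma scoreE (R : realType) n p (T : Type) (X : 'M[R]_(n, p))
    (eps : 'I_n -> T -> R) (s : R) w j :
  (s^-1 *: (X^T *m \col_i eps i w)) j 0 = \sum_i X i j / s * eps i w.
Proof. by rewrite !mxE mulr_sumr; apply: eq_bigr => i _; rewrite !mxE; ring. Qed.

Lemma measurable_score (R : realType) n p d (T : measurableType d)
    (X : 'M[R]_(n, p)) (eps : 'I_n -> {mfun T >-> R}) (s : R) j :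
  measurable_fun setT (fun w => (s^-1 *: (X^T *m \col_i eps i w)) j 0).
Proof.
under eq_fun do rewrite (scoreE X (fun i => eps i : T -> R)).
by apply: measurable_sum => i; exact: measurable_funM.
Qed.

(** Union bound over the coordinates of the score; the Gram matrix appears
    because the variance of the j-th coordinate is sigma^2 (X'X)_jj / s^2. *)
Lemma score_tail (R : realType) n p d (T : measurableType d)
    (P : probability T R) (X : 'M[R]_(n, p)) (eps : 'I_n -> {RV P >-> R})
    (sigma s e : R) :
  mutually_independent eps -> (forall i, 'E_P[eps i] = 0)%E ->
  (forall i, 'V_P[eps i] = (sigma ^+ 2)%:E)%E -> 0 < s -> 0 < e ->
  forall B : set T, measurable B ->
  (forall w, B w -> exists j, e <= `|(s^-1 *: (X^T *m \col_i eps i w)) j 0|) ->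
  (P B <= (e ^- 2 * (sigma ^+ 2 * (\tr (X^T *m X) / s ^+ 2)))%:E)%E.
Proof.
move=> eind emean evar s0 e0 B mB hB.
pose G j := [set w | e <= `|\sum_i X i j / s * eps i w|].
have mG j : measurable (G j).
  rewrite -[G j]setTI (_ : G j =
    (Num.norm \o (fun w => (s^-1 *: (X^T *m \col_i eps i w)) j 0))
      @^-1` `[e, +oo[); last first.
    apply/seteqP; split => w /=; rewrite in_itv/= andbT;
      by rewrite (scoreE X (fun i => eps i : T -> R)).
  exact: (measurableT_comp _ (measurable_score X eps s j)).
apply: (@le_trans _ _ (\sum_j P (G j))%E).
  rewrite fsbig_seq ?index_enum_uniq//; apply: content_sub_fsum => //.
  move=> w /hB[j]; rewrite (scoreE X (fun i => eps i : T -> R)) => Gw.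
  exists j => //.
  by rewrite /= mem_index_enum.
apply: (@le_trans _ _ (\sum_j
    (e ^- 2 * (sigma ^+ 2 * (\sum_i (X i j / s) ^+ 2)))%:E)%E).
  by apply: lee_sum => j _; exact: chebyshev_weighted_sum.
rewrite sumEFin lee_fin -!mulr_sumr /mxtrace mulr_suml.
by under eq_bigr do rewrite sum_sqr_design.
Qed.

(** * Convergence in probability *)

Theorem proposition12 (R : realType) (p : nat)
  (d : nat -> measure_display) (T : forall n, measurableType (d n))
  (P : forall n, probability (T n) R)
  (x : nat -> 'rV[R]_p) (C : 'M[R]_p) (beta : nat -> 'cV[R]_p)
  (eps : forall n, 'I_n -> {RV (P n) >-> R}) (sigma : R)
  (lam : nat -> 'I_p -> R) (lam0 : 'I_p -> R) (zeta : 'I_p -> \bar R)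
  (hrank : forall n, (p <= n)%N -> \rank (design x n) = p)
  (hC : forall i j,
    ((design x n)^T *m design x n) i j / n%:R @[n --> \oo] --> C i j)
  (hCpos : posdef C)
  (hindep : forall n, (p <= n)%N -> mutually_independent (eps n))
  (hident : forall n n' (i : 'I_n) (i' : 'I_n') (A : set R),
    (p <= n)%N -> (p <= n')%N -> measurable A ->
    distribution (P n) (eps n i) A = distribution (P n') (eps n' i') A)
  (hmean : forall n (i : 'I_n), (p <= n)%N -> ('E_(P n)[eps n i] = 0)%E)
  (hvar : forall n (i : 'I_n), (p <= n)%N ->
    ('V_(P n)[eps n i] = (sigma ^+ 2)%:E)%E)
  (hlam_ge0 : forall n j, (p <= n)%N -> 0 <= lam n j)
  (hlam_sqrt : exists j : 'I_p,
    lam n j / Num.sqrt n%:R @[n --> \oo] --> +oo)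
  (hlam_n : forall j, lam n j / n%:R @[n --> \oo] --> (0 : R))
  (hlam0 : forall j, lam n j / max_tuning (lam n) @[n --> \oo] --> lam0 j)
  (hlam0_01 : forall j, 0 <= lam0 j <= 1)
  (hzeta : forall j,
    (n%:R * beta n j 0 / max_tuning (lam n))%:E @[n --> \oo] --> zeta j) :
  let m := argmin (Vlim C lam0 zeta) in
  unique_minimizer (Vlim C lam0 zeta) m /\
  cvg_in_probability P
    (fun n w => (n%:R / max_tuning (lam n)) *:
       (lasso (design x n) (lam n) (response (design x n) (beta n) (eps n) w)
        - beta n)) m.

Proof.
move=> m.
have [c c0 Cc] := posdef_coercive hCpos.
have hcvx j : midconvex (shifted_abs_lim (lam0 j) (zeta j)).
  by apply: midconvex_shifted_abs_lim; case/andP: (hlam0_01 j).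
have hlip j : lipschitz_fun 1 (shifted_abs_lim (lam0 j) (zeta j)).
  have /andP[l0 l1] := hlam0_01 j.
  by apply: (lipschitz_funW l1); exact: lipschitz_shifted_abs_lim.
have [m' m'min] := sepquad_exists_minimizer c0 Cc hcvx hlip.
have mE : m = m' by exact: argmin_unique m'min.
have mmin : unique_minimizer (Vlim C lam0 zeta) m by rewrite mE.
split=> // e e0.
case: hlam_sqrt => j0 hj0.
have sgt0 : \forall n \near \oo, 0 < max_tuning (lam n).
  move/cvgryPgt : (hj0) => /(_ 0); apply: filterS => n lamn.
  apply: lt_le_trans (le_max_tuning _ j0); rewrite ltNge; apply/negP => lam_le0.
  by move: lamn; rewrite ltNge mulr_le0_ge0// invr_ge0 sqrtr_ge0.
pose C_ n : 'M[R]_p := n%:R^-1 *: ((design x n)^T *m design x n).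
pose s n := max_tuning (lam n).
pose l_ n j := lam n j / s n.
pose z_ n j := n%:R * beta n j 0 / s n.
have C_cvg i j : C_ n i j @[n --> \oo] --> C i j.
  by rewrite /C_; under eq_cvg do rewrite mxE mulrC; exact: hC.
have l_01 : \forall n \near \oo, forall j, 0 <= l_ n j <= 1.
  near=> n => j; have sn : 0 < s n by near: n.
  rewrite divr_ge0 ?(ltW sn)/= ?hlam_ge0//; last by near: n; exact: nbhs_infty_ge.
  by rewrite ler_pdivrMr// mul1r le_max_tuning.
have [dl dl0 Hdl] := minimizer_cvg C_cvg hlam0 hzeta hlam0_01 l_01 c0 Cc mmin
  (exprn_gt0 2 e0).
have p0 : 0 < p%:R :> R by rewrite ltr0n; case: (j0) => k; exact: leq_ltn_trans.
(* If every coordinate of the score is below et in absolute value, then its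
   squared norm is at most dl. *)
pose et := Num.sqrt (dl / p%:R).
have et0 : 0 < et by rewrite sqrtr_gt0 divr_gt0.
have Ccoer : \forall n \near \oo, coercive (C_ n) (c / 2).
  rewrite (_ : c / 2 = c - c / 2); last by field.
  have := matrix_dist_cvg0 C_cvg (divr_gt0 c0 (ltr0n R 2)).
  by apply: filterS => n; exact: coercive_perturb.
pose bd n := et ^- 2 * (sigma ^+ 2 * (\tr (C_ n) * (n%:R / s n ^+ 2))).
have bd0 : (bd n)%:E @[n --> \oo] --> 0%E.
  apply: cvg_EFin; first exact: nearW.
  rewrite -[X in _ --> X](mulr0 (et ^- 2)); apply: cvgMl_tmp.
  rewrite -[X in _ --> X](mulr0 (sigma ^+ 2)); apply: cvgMl_tmp.
  rewrite -[X in _ --> X](mulr0 (\tr C)); apply: cvgM.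
    by apply: cvg_sumr => i; exact: C_cvg.
  exact: noise_vanishes hj0.
apply: (squeeze_cvge _ (cvg_cst 0%E) bd0).
near=> n; rewrite measure_ge0 /=.
have sn : 0 < s n by near: n.
have n0 : (0 < n)%N by near: n; exact: nbhs_infty_gt.
have pn : (p <= n)%N by near: n; exact: nbhs_infty_ge.
have Cn : coercive (C_ n) (c / 2) by near: n.
have l01 j : 0 <= l_ n j <= 1 by move: j; near: n.
have Hn : forall w u, sqnorm w <= dl ->
    unique_minimizer (sepquad (C_ n)
      (tilt (fun j => shifted_abs (l_ n j) (z_ n j)) w)) u ->
    sqnorm (u - m) <= e ^+ 2 by near: n.
have c20 : 0 < c / 2 by exact: divr_gt0.
pose h j := shifted_abs (l_ n j) (z_ n j).
have hncvx j : midconvex (h j).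
  by apply: midconvex_shifted_abs; case/andP: (l01 j).
(* The minimizer as a function of the score, for this fixed n. *)
have /choice[u umin] : forall w : 'cV[R]_p,
    exists u, unique_minimizer (sepquad (C_ n) (tilt h w)) u.
  move=> w; apply: (@sepquad_exists_minimizer _ _ _ _ (c / 2)
    (1 + \sum_j `|w j 0|)) => // j.
    exact: midconvex_linear.
  have /andP[l0 l1] := l01 j.
  apply: (lipschitz_funW (L := l_ n j + `|w j 0|)).
    by rewrite lerD// (bigD1 j)//= lerDl sumr_ge0.
  exact/lipschitz_linear/lipschitz_shifted_abs.
pose W w : 'cV[R]_p := (s n)^-1 *: ((design x n)^T *m \col_i eps n i w).
have ZE w : (n%:R / max_tuning (lam n)) *: (lasso (design x n) (lam n)
    (response (design x n) (beta n) (eps n) w) - beta n) = u (W w).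
  exact: lasso_rescale n0 sn (umin (W w)).
have far : [set w | e < Num.sqrt (sqnorm ((n%:R / max_tuning (lam n)) *:
      (lasso (design x n) (lam n)
        (response (design x n) (beta n) (eps n) w) - beta n) - m))] =
    W @^-1` [set v | e ^+ 2 < sqnorm (u v - m)].
  apply/seteqP; split => w /=; rewrite ZE.
    move=> h1; rewrite -(sqr_sqrtr (sqnorm_ge0 _)) ltr_pXn2r// nnegrE ?ltW//.
    exact: lt_trans h1.
  by rewrite -{1}(sqr_sqrtr (sqnorm_ge0 (u (W w) - m))) ltr_pXn2r// nnegrE
    ?sqrtr_ge0// ltW.
rewrite far.
rewrite (_ : bd n = et ^- 2 * (sigma ^+ 2 *
    (\tr ((design x n)^T *m design x n) / s n ^+ 2))); last first.
  rewrite /bd /C_ mxtraceZ; field.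
  by rewrite !lt0r_neq0 ?ltr0n.
apply: (score_tail (hindep n pn) (fun i => hmean n i pn) (fun i => hvar n i pn)
  sn et0).
  apply: measurable_open_preimage.
    by move=> j; exact: measurable_score.
  exact: open_minimizer_far c20 Cn hncvx umin.
move=> w; rewrite /= ltNge => /negP farw; apply: contrapT => /forallNP small.
apply: farw; have := umin (W w); have : sqnorm (W w) <= dl.
  rewrite -(divfK (lt0r_neq0 p0) dl).
  apply: le_trans (_ : \sum_(j < p) dl / p%:R <= _); last first.
    by rewrite sumr_const card_ord mulr_natr.
  apply: ler_sum => j _; have /negP := small j; rewrite -ltNge => /ltW wj.
  have -> : dl / p%:R = et ^+ 2 by rewrite sqr_sqrtr// divr_ge0 ?ltW.
  by rewrite -(real_normK (num_real (W w j 0))) ler_pXn2r ?nnegrE// ltW.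
by move=> W_small /(Hn _ _ W_small).
Unshelve. all: by end_near.
Qed.
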